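(* Let $(F_n)$ be a sequence of arbitrary finite subsets of a countably infinite cancellative semigroup $G$. Suppose that there exists a 0-1-valued function $x\in\{0,1\}^G$ such that for every two-element set $K\subset G$ we have $$\lim_{n\to\infty}\frac1{|F_n|}\sum_{B\in\{0,1\}^K}\mathsf N(B,x,F_n)=1.$$ Then $(F_n)$ is a F{\o}lner sequence in $G$.
   Context: A semigroup $G$ is (two-sided) cancellative if $ab=ac\Rightarrow b=c$ and $ba=ca\Rightarrow b=c$. The sets $F_n$ are understood to be nonempty. For nonempty finite $K\subset G$, $B\in\{0,1\}^K$, $x\in\{0,1\}^G$ and finite $F\subset G$: $\mathsf N(B,x,F)=|\{g\in G\cup\{e\}: (\forall h\in K)\ hg\in F\text{ and }x_{hg}=B(h)\}|$, where $e$ is a formal identity element added to $G$ in case $G$ lacks one. For $g\in G$, $F\subset G$: $g^{-1}F=\{h\in G: gh\in F\}$. $(F_n)$ is a (left) F{\o}lner sequence if $\lim_n |F_n\cap g^{-1}F_n|/|F_n|=1$ for every $g\in G$. *)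

(* Defs.v *)
From HB Require Import structures.
From mathcomp Require Import all_boot all_order all_algebra finmap.
From mathcomp Require Import all_classical all_reals all_analysis.
Import Order.TTheory GRing.Theory Num.Theory.
Import numFieldNormedType.Exports.

Set Implicit Arguments.
Unset Strict Implicit.
Unset Printing Implicit Defensive.

Local Open Scope classical_set_scope.
Local Open Scope fset_scope.

Section Semigroup.
Variable G : semigroupType.

Definition cancellative : Prop :=
  (forall a b c : G, (a * b = a * c)%g -> b = c) /\
  (forall a b c : G, (b * a = c * a)%g -> b = c).

Definition has_identity : Prop :=
  exists u : G, forall a : G, (u * a)%g = a /\ (a * u)%g = a.

(* G u {e}, inside [option G]: [None] is the formal identity e, and it belongs
   to the set only when G has no identity of its own. *)
Definition with_identity : set (option G) :=
  [set g | g = None -> ~ has_identity].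

(* h g for h in G and g in G u {e}. *)
Definition mulo (h : G) (g : option G) : G :=
  if g is Some g' then (h * g')%g else h.

(* The positions g at which the block B over K occurs in x inside F. *)
Definition occurrences (K : {fset G}) (B : {ffun K -> bool}) (x : G -> bool)
    (F : {fset G}) : set (option G) :=
  [set g | with_identity g /\
     forall h : K, mulo (val h) g \in F /\ x (mulo (val h) g) = B h].

(* [fset_set] returns the empty set on infinite sets; this does not interfere
   when G is cancellative and K is nonempty, by [finite_occurrences]. *)
Definition blockN (K : {fset G}) (B : {ffun K -> bool}) (x : G -> bool)
    (F : {fset G}) : nat :=
  #|` fset_set (occurrences B x F)|.

Lemma finite_occurrences (K : {fset G}) (B : {ffun K -> bool}) (x : G -> bool)
    (F : {fset G}) :
  cancellative -> K != fset0 -> finite_set (occurrences B x F).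
Proof.
move=> [cancel_left _] /fset0Pn[h hK].
have inj_h : injective (fun g : G => (h * g)%g).
  by move=> b c; exact: cancel_left.
have fin_h : finite_set [set g : G | (h * g)%g \in F].
  apply: (@finite_preimage _ _ [set` F] (fun g : G => (h * g)%g)).
    by move=> b c _ _; exact: inj_h.
  exact: finite_fset.
apply: (@sub_finite_set _ _
  ([set None] `|` Some @` [set g : G | (h * g)%g \in F])).
  move=> [g|] [_ occ]; last by left.
  by right; exists g => //; case: (occ [` hK]).
by rewrite finite_setU; split; [exact: finite_set1 | exact: finite_image].
Qed.

(* g^{-1} F *)
Definition ldiv (g : G) (F : set G) : set G := [set h | F (g * h)%g].

Definition folner (R : realType) (F : nat -> {fset G}) : Prop :=
  forall g : G,
    ((#|` [fset h in F n | h \in ldiv g [set` F n]]|%:R / #|` F n|%:R : R)%R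
       @[n --> \oo] --> (1 : R)%R).

End Semigroup.

(* Main.v *)
Require Import Defs.
From HB Require Import structures.
From mathcomp Require Import all_boot all_order all_algebra finmap.
From mathcomp Require Import all_classical all_reals all_analysis.
Import Order.TTheory GRing.Theory Num.Theory.
Import numFieldNormedType.Exports.

(** A position [k] counted by the Følner ratio of [g] is one with [k] and
    [g * k] both in [F].  For [K = {a, g * a}], an element [h] of [G u {e}] is
    an occurrence of some block over [K] exactly when [k = a * h] is such a
    position, so [h |-> a * h] embeds the disjoint union of all occurrence sets
    into [F :&: g^-1 F]; this is [sum_blockN_le].  The function [x] only serves to
    distribute the occurrences among the blocks.  Hence the Følner ratio lies
    between the given averages and [1], and a squeeze concludes.

    The embedding is injective at the formal identity because in a cancellative
    semigroup [a * h = a] forces [h] to be an identity ([mulo_inj]), in which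
    case [e] is not added.  The set [K] has two elements for [a = g] unless
    [g * g = g]; but then [g] is a left identity and all ratios equal [1]. *)

Local Open Scope classical_set_scope.
Local Open Scope fset_scope.
Local Open Scope ring_scope.

(** If [a * h = a] then [a * (h * y) = a * y], so [h] is a left identity by
    left cancellation; from [y * (h * h) = y * h], right cancellation makes it a
    right identity as well. *)
Lemma fix_has_identity (G : semigroupType) (a h : G) :
  cancellative G -> (a * h = a)%g -> has_identity G.
Proof.
move=> [cancelL cancelR] aha; exists h.
have hl y : (h * y = y)%g by apply: (cancelL a); rewrite mulgA aha.
by move=> y; split=> //; apply: (cancelR h); rewrite -mulgA hl.
Qed.

Lemma idem_left_identity (G : semigroupType) (g : G) :
  cancellative G -> (g * g = g)%g -> forall y : G, (g * y = y)%g.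
Proof. by move=> [cancelL _] ggg y; apply: (cancelL g); rewrite mulgA ggg. Qed.

Lemma mulo_inj (G : semigroupType) (a : G) :
  cancellative G -> {in with_identity (G := G) &, injective (Defs.mulo a)}.
Proof.
move=> cancelG [u|] [v|] //; rewrite !inE /with_identity /=.
- by move=> _ _ /cancelG.1 ->.
- by move=> _ /(_ erefl) nid /(fix_has_identity _ _ _ cancelG)/nid.
- by move=> /(_ erefl) nid _ /esym/(fix_has_identity _ _ _ cancelG)/nid.
Qed.

(** The block read at [h] over [{a, g * a}] depends only on [k = a * h]: its
    entries are [x k] and [x (g * k)].  So each [k] in [F :&: g^-1 F] is charged
    to a single block. *)
Lemma sum_blockN_le (G : semigroupType) (g a : G) (x : G -> bool)
    (F : {fset G}) :
  cancellative G ->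
  (\sum_(B : {ffun [fset a; (g * a)%g] -> bool}) blockN B x F
   <= #|` [fset k in F | k \in ldiv g [set` F]]|)%N.
Proof.
move=> cancelG; set K := [fset a; _]; set S := [fset k in F | _].
pose block_at k := [ffun h : K => x (if val h == a then k else (g * k)%g)].
have aK : a \in K by rewrite !inE eqxx.
have gaK : (g * a)%g \in K by rewrite !inE eqxx orbT.
have le_block B : (blockN B x F <= \sum_(k <- S) (block_at k == B))%N.
  have finB : finite_set (occurrences B x F).
    by apply: finite_occurrences => //; apply/fset0Pn; exists a.
  have mulo_ga h : Defs.mulo (g * a)%g h = (g * Defs.mulo a h)%g.
    by case: h => [h|] //=; rewrite mulgA.
  have -> : blockN B x F
      = #|` [fset Defs.mulo a h | h in fset_set (occurrences B x F)]|.
    rewrite card_in_imfset //= => u v; rewrite !in_fset_set // !inE.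
    by move=> -[uid _] [vid _]; apply: mulo_inj; rewrite ?inE.
  rewrite (_ : \sum_(k <- S) _ = \sum_(k <- S | block_at k == B) 1)%N; last first.
    by rewrite [RHS]big_mkcond; apply: eq_bigr => k _; case: eqP.
  rewrite big_fset_condE /= -card_fset_sum1.
  apply/fsubset_leq_card/fsubsetP => _ /imfsetP[h /= + ->].
  rewrite in_fset_set // inE => -[_ occ].
  have [aF _] := occ [` aK]; have [gaF _] := occ [` gaK].
  rewrite !inE /= aF mem_set /=; last by rewrite /ldiv /= -mulo_ga.
  apply/eqP/ffunP => i; rewrite ffunE -(occ i).2; congr x.
  case: eqP => [->//|/eqP neq_a].
  have := valP i; rewrite !inE (negPf neq_a) /= => /eqP ->.
  by rewrite mulo_ga.
apply: (@leq_trans (\sum_B \sum_(k <- S) (block_at k == B))%N).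
  by apply: leq_sum.
rewrite exchange_big /= card_fset_sum1.
apply: leq_sum => k _; rewrite (bigD1 (block_at k)) //= eqxx big1 // => B.
by rewrite eq_sym => /negPf ->.
Qed.

Theorem theorem2p10 (R : realType) (G : semigroupType)
    (G_countable : countable [set: G]) (G_infinite : infinite_set [set: G])
    (G_cancellative : cancellative G)
    (F : nat -> {fset G}) (F_nonempty : forall n : nat, F n != fset0)
    (F_blocks : exists x : G -> bool,
       forall K : {fset G}, #|` K| = 2%N ->
         (#|` F n|%:R^-1 *
            \sum_(B : {ffun K -> bool}) (blockN B x (F n))%:R : R)
           @[n --> \oo] --> (1 : R)) :
  folner R F.
Proof.
have [x block_cvg] := F_blocks.
move=> g.
have F_gt0 n : 0 < #|` F n|%:R :> R by rewrite ltr0n cardfs_gt0.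
have [ggg|/eqP gg_neq] := eqVneq g (g * g)%g.
  rewrite (_ : (fun n => _) = cst (1 : R)); first exact: cvg_cst.
  apply/funext => n /=.
  rewrite (_ : [fset _ in _ | _] = F n) ?divff ?gt_eqF //.
  apply/fsetP => h; rewrite !inE /=; case: (boolP (h \in F n)) => //= hF.
  by apply: mem_set; rewrite /ldiv /= idem_left_identity.
have K2 : #|` [fset g; (g * g)%g]| = 2%N by rewrite cardfs2; case: eqP.
apply: squeeze_cvgr; [|exact: block_cvg K2|exact: cvg_cst].
apply: nearW => n; apply/andP; split.
  rewrite mulrC ler_pM2r ?invr_gt0 // -natr_sum ler_nat.
  exact: sum_blockN_le.
rewrite ler_pdivrMr // mul1r ler_nat.
by apply/fsubset_leq_card/fsubsetP => h; rewrite !inE => /andP[].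
Qed.
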